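(* Let $G\subset\mathbb{R}^3$ be a bounded domain with smooth ($C^\infty$) boundary $\Gamma$ and normal vector $\mathbf{n}$. Consider the two spectral problems: (P) Find all nonzero eigenvalues $\mu$ and eigen-vector-functions $\mathbf{u}(\mathbf{x})$ in $\mathbf{L}_2(G)$ of the gradient-of-divergence operator such that $-\nabla\operatorname{div}\mathbf{u}=\mu\mathbf{u}$ in $G$, $\mathbf{n}\cdot\mathbf{u}|_\Gamma=0$. (N) Find all eigenvalues $\nu$ and eigenfunctions $g(\mathbf{x})$ of the Laplace operator $-\Delta$ such that $-\Delta g=\nu g$ in $G$, $\mathbf{n}\cdot\nabla g|_\Gamma=0$. To any solution $(\mu,\mathbf{u})$ of problem (P) in the domain $G$ there corresponds a solution $(\nu,g)=(\mu,\operatorname{div}\mathbf{u})$ of problem (N). Conversely, to any solution $(\nu,g)$ of problem (N) there corresponds a solution $(\mu,\mathbf{u})=(\nu,\nabla g)$ of problem (P).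
   Context: $\mathbf{L}_2(G)$ is the space of vector-functions square-integrable over $G$, and $\mathbf{n}\cdot\mathbf{u}$ is the projection of the vector $\mathbf{u}$ onto the normal vector $\mathbf{n}$. Solutions of both problems belong to the class $C^\infty(\overline{G})$, since $\Gamma\in C^\infty$.
   Formalization: In the converse, ν is assumed nonzero: for ν = 0 the constant g = 1 solves (N), but ∇g = 0 with eigenvalue 0 is not a solution of (P), which asks for nonzero eigenvalues and eigen-vector-functions. *)

(* Defs.v *)
From HB Require Import structures.
From mathcomp Require Import all_boot all_order all_algebra.
From mathcomp Require Import all_classical all_reals all_analysis.

Set Implicit Arguments.
Unset Strict Implicit.
Unset Printing Implicit Defensive.

Import Order.TTheory GRing.Theory Num.Theory.
Import numFieldNormedType.Exports.

Local Open Scope classical_set_scope.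
Local Open Scope ring_scope.

(* Scalar and vector fields are total functions on 'rV[R]_3, but a field on an
   open set G only matters through its values on G: derivatives are taken at
   points of G, and boundary values are limits from inside G. *)

Definition partial (R : realType) (i : 'I_3) (f : 'rV[R]_3 -> R) :
  'rV[R]_3 -> R := fun x => 'D_(delta_mx 0 i) f x.

Definition iter_partial (R : realType) (s : seq 'I_3) (f : 'rV[R]_3 -> R) :
  'rV[R]_3 -> R := foldr (@partial R) f s.

Definition coordf (R : realType) (i : 'I_3) (u : 'rV[R]_3 -> 'rV[R]_3) :
  'rV[R]_3 -> R := fun x => u x 0 i.

Definition grad (R : realType) (f : 'rV[R]_3 -> R) : 'rV[R]_3 -> 'rV[R]_3 :=
  fun x => \row_i partial i f x.

Definition div (R : realType) (u : 'rV[R]_3 -> 'rV[R]_3) : 'rV[R]_3 -> R :=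
  fun x => \sum_(i < 3) partial i (coordf i u) x.

Definition laplacian (R : realType) (f : 'rV[R]_3 -> R) : 'rV[R]_3 -> R :=
  fun x => \sum_(i < 3) partial i (partial i f) x.

Definition dot (R : realType) (v w : 'rV[R]_3) : R :=
  \sum_(i < 3) v 0 i * w 0 i.

(* The library norm on 'rV[R]_3 is the maximum norm. *)
Definition enorm (R : realType) (v : 'rV[R]_3) : R := Num.sqrt (dot v v).

Definition smooth_on (R : realType) (D : set 'rV[R]_3) (f : 'rV[R]_3 -> R) :
  Prop :=
  forall (s : seq 'I_3) x, D x ->
    {for x, continuous (iter_partial s f)} /\
    forall i, derivable (iter_partial s f) x (delta_mx 0 i).

(* C^oo(closure D): f is C^oo in the open set D, and every partial derivative
   of f has a continuous extension to the closure of D. *)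
Definition smooth_closure (R : realType) (D : set 'rV[R]_3)
    (f : 'rV[R]_3 -> R) : Prop :=
  smooth_on D f /\
  forall s : seq 'I_3, exists h : 'rV[R]_3 -> R,
    {within closure D, continuous h} /\
    forall x, D x -> h x = iter_partial s f x.

Definition smooth_closure_vec (R : realType) (D : set 'rV[R]_3)
    (u : 'rV[R]_3 -> 'rV[R]_3) : Prop :=
  forall i, smooth_closure D (coordf i u).

Definition boundary (R : realType) (D : set 'rV[R]_3) : set 'rV[R]_3 :=
  closure D `\` interior D.

Definition bounded_domain (R : realType) (G : set 'rV[R]_3) : Prop :=
  [/\ open G, connected G, G !=set0 & bounded_set G].

(* rho is a C^oo local defining function of G on the open neighbourhood U of x;
   inside U the boundary of G is then the level set rho = 0. *)
Definition local_defining_function (R : realType) (G : set 'rV[R]_3)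
    (x : 'rV[R]_3) (U : set 'rV[R]_3) (rho : 'rV[R]_3 -> R) : Prop :=
  [/\ open U, U x, smooth_on U rho,
      (forall y, U y -> grad rho y != 0)
    & (forall y, U y -> (G y <-> rho y < 0))].

Definition smooth_boundary (R : realType) (G : set 'rV[R]_3) : Prop :=
  forall x, boundary G x ->
    exists U rho, local_defining_function G x U rho.

Definition outward_unit_normal (R : realType) (G : set 'rV[R]_3)
    (n : 'rV[R]_3 -> 'rV[R]_3) : Prop :=
  forall x, boundary G x ->
    exists U rho, local_defining_function G x U rho /\
      n x = (enorm (grad rho x))^-1 *: grad rho x.

(* The boundary value at x of a field continuous up to the boundary is its limit
   at x from inside G; so this is (n . u)|_Gamma = 0. *)
Definition zero_normal_trace (R : realType) (G : set 'rV[R]_3)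
    (n u : 'rV[R]_3 -> 'rV[R]_3) : Prop :=
  forall x, boundary G x ->
    (fun y => dot (n x) (u y)) @ within G (nbhs x) --> (0 : R).

(* Lebesgue measure on R^3 is the product measure on R * R * R. *)
Definition lebesgue3 (R : realType) :=
  ((@lebesgue_measure R \x @lebesgue_measure R) \x @lebesgue_measure R)%E.

Definition vec3 (R : realType) (p : R * R * R) : 'rV[R]_3 :=
  \row_(i < 3) tnth [tuple p.1.1; p.1.2; p.2] i.

Definition L2_vec (R : realType) (G : set 'rV[R]_3)
    (u : 'rV[R]_3 -> 'rV[R]_3) : Prop :=
  let D : set (measurableTypeR R * measurableTypeR R * measurableTypeR R) :=
    @vec3 R @^-1` G in
  (forall i, measurable_fun D (fun p => coordf i u (vec3 p))) /\
  (\int[@lebesgue3 R]_(p in D) ((enorm (u (vec3 p)) ^+ 2)%:E) < +oo)%E.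

(* As the boundary is C^oo, solutions of both problems lie in C^oo(closure G). *)
Definition solution_P (R : realType) (G : set 'rV[R]_3)
    (n : 'rV[R]_3 -> 'rV[R]_3) (mu : R) (u : 'rV[R]_3 -> 'rV[R]_3) : Prop :=
  mu != 0 /\ (exists2 x, G x & u x != 0) /\
  L2_vec G u /\ smooth_closure_vec G u /\
  (forall x, G x -> - grad (div u) x = mu *: u x) /\
  zero_normal_trace G n u.

Definition solution_N (R : realType) (G : set 'rV[R]_3)
    (n : 'rV[R]_3 -> 'rV[R]_3) (nu : R) (g : 'rV[R]_3 -> R) : Prop :=
  (exists2 x, G x & g x != 0) /\
  smooth_closure G g /\
  (forall x, G x -> - laplacian g x = nu * g x) /\
  zero_normal_trace G n (grad g).

(* Main.v *)
(* Taking the divergence of - grad (div u) = mu u gives the equation for div u,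
   and taking the gradient of - laplacian g = nu g gives the equation for grad g.
   The conormal condition on div u is the condition on u because grad (div u) is
   - mu u inside G. Neither div u nor grad g vanishes identically, since mu and
   nu are nonzero. Finally grad g is square integrable because its coordinates
   extend continuously to the closure of G, which is compact. *)
Require Import Defs.
From HB Require Import structures.
From mathcomp Require Import all_boot all_order all_algebra.
From mathcomp Require Import all_classical all_reals all_analysis.
From mathcomp Require Import measurable_realfun.

Set Implicit Arguments.
Unset Strict Implicit.
Unset Printing Implicit Defensive.

Import Order.TTheory GRing.Theory Num.Theory.
Import numFieldNormedType.Exports.

Local Open Scope classical_set_scope.
Local Open Scope ring_scope.

(** * Calculus of iterated partial derivatives on an open set *)

Section partial_derivatives.
Context {R : realType}.
Implicit Types (D : set 'rV[R]_3) (f g : 'rV[R]_3 -> R) (s : seq 'I_3).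

(** A derivative at a point depends only on the germ there, and openness turns equality on [D] into
    equality of germs. *)
Lemma eq_open_partial D i f g : open D -> {in D, f =1 g} ->
  {in D, partial i f =1 partial i g}.
Proof.
move=> oD fg x /set_mem Dx; apply: near_eq_derive.
by apply: filterS (open_nbhs_nbhs (conj oD Dx)) => y /mem_set /fg.
Qed.

Lemma eq_open_iter_partial D s f g : open D -> {in D, f =1 g} ->
  {in D, iter_partial s f =1 iter_partial s g}.
Proof. by move=> oD fg; elim: s => //= i s; exact: eq_open_partial. Qed.

(** [foldr] applies the last index of the list first. Smoothness quantifies over all lists, so this
    makes it stable under [partial i]. *)
Lemma iter_partial_rcons s i f :
  iter_partial s (partial i f) = iter_partial (rcons s i) f.
Proof. by rewrite /iter_partial foldr_rcons. Qed.

Lemma partialZ i (c : R) f x : derivable f x (delta_mx 0 i) ->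
  partial i (fun y => c * f y) x = c * partial i f x.
Proof. exact: deriveZ. Qed.

Lemma iter_partial0 s : iter_partial s (cst 0) = cst 0 :> ('rV[R]_3 -> R).
Proof.
elim: s => //= i s ->.
by apply/funext => x; rewrite /partial derive_cst.
Qed.

(** Derivability is known only on [D], so the induction carries an equality on [D] and
    differentiates it by openness. *)
Lemma iter_partialD D s f g : open D -> smooth_on D f -> smooth_on D g ->
  {in D, iter_partial s (f \+ g) =1 iter_partial s f \+ iter_partial s g}.
Proof.
move=> oD sf sg; elim: s => //= i s IH x xD.
rewrite (eq_open_partial i oD IH xD).
by apply: deriveD; [apply: (sf s x _).2|apply: (sg s x _).2]; exact: set_mem.
Qed.

Lemma smooth_on_derivable D f x i : smooth_on D f -> D x ->
  derivable f x (delta_mx 0 i).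
Proof. by move=> sf Dx; exact: (sf [::] x Dx).2. Qed.

Lemma smooth_on_partial D f i : smooth_on D f -> smooth_on D (partial i f).
Proof. by move=> sf s; rewrite iter_partial_rcons; exact: sf. Qed.

Lemma smooth_closure_partial D f i :
  smooth_closure D f -> smooth_closure D (partial i f).
Proof.
move=> [sf ef]; split; first exact: smooth_on_partial.
by move=> s; rewrite iter_partial_rcons; exact: ef.
Qed.

Lemma smooth_closure0 D : smooth_closure D (cst 0 : 'rV[R]_3 -> R).
Proof.
split=> [s x Dx|s].
  rewrite iter_partial0; split=> [|i]; first exact: cst_continuous.
  exact: derivable_cst.
exists (cst 0); split=> [|x _]; last by rewrite iter_partial0.
by apply: continuous_subspaceT => x; exact: cst_continuous.
Qed.

Lemma smooth_closureD D f g : open D -> smooth_closure D f ->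
  smooth_closure D g -> smooth_closure D (f \+ g).
Proof.
move=> oD [sf ef] [sg eg]; have fgE := iter_partialD _ oD sf sg.
split=> [s x Dx|s].
  (* Continuity and derivability at [x] need equality on a neighbourhood, not merely at [x]. *)
  have nfg : {near x, iter_partial s f \+ iter_partial s g
                        =1 iter_partial s (f \+ g)}.
    apply: filterS (open_nbhs_nbhs (conj oD Dx)) => y Dy.
    by rewrite fgE ?inE.
  have [cf df] := sf s x Dx; have [cg dg] := sg s x Dx; split=> [|i].
    rewrite /prop_for /continuous_at fgE ?inE//.
    by apply: cvg_trans (near_eq_cvg nfg) (cvgD cf cg).
  by apply: near_eq_derivable nfg _; exact: derivableD.
have [h [ch hE]] := ef s; have [k [ck kE]] := eg s.
exists (h \+ k); split=> [x|x Dx]; first exact: cvgD (ch x) (ck x).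
by rewrite fgE ?inE//= hE// kE.
Qed.

Lemma smooth_closure_sum D n (h : 'I_n -> 'rV[R]_3 -> R) : open D ->
  (forall i, smooth_closure D (h i)) ->
  smooth_closure D (fun x => \sum_(i < n) h i x).
Proof.
move=> oD sh; rewrite (_ : (fun x => _) = \sum_(i < n) h i); last first.
  by apply/funext => x; rewrite fct_sumE.
apply: (big_ind (smooth_closure D)) => //; first exact: smooth_closure0.
by move=> f g; exact: smooth_closureD.
Qed.

Lemma coordf_grad i f : coordf i (grad f) = partial i f.
Proof. by apply/funext => x; rewrite /coordf mxE. Qed.

Lemma div_grad f : div (grad f) = laplacian f.
Proof.
by apply/funext => x; apply: eq_bigr => i _; rewrite coordf_grad.
Qed.

Lemma grad_constant_zero D f : open D -> {in D, f =1 cst 0} ->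
  {in D, grad f =1 cst 0}.
Proof.
move=> oD f0 x xD; apply/rowP => i.
by rewrite !mxE (eq_open_partial i oD f0 xD) /partial derive_cst.
Qed.

(** Used to show that an eigenfunction with nonzero eigenvalue has a gradient that is not
    identically zero. *)
Lemma grad_zero_laplacian D f : open D -> {in D, grad f =1 cst 0} ->
  {in D, laplacian f =1 cst 0}.
Proof.
move=> oD gf0 x xD; apply: big1 => i _.
have pf0 : {in D, partial i f =1 cst 0}.
  by move=> y /gf0 /rowP /(_ i); rewrite !mxE.
by rewrite (eq_open_partial i oD pf0 xD) /partial derive_cst.
Qed.

Lemma dotZr (c : R) (v w : 'rV[R]_3) : dot v (c *: w) = c * dot v w.
Proof.
by rewrite /dot mulr_sumr; apply: eq_bigr => i _; rewrite mxE mulrCA.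
Qed.

(** The trace is a limit from inside [D], so a relation between the fields on [D] alone is
    enough. *)
Lemma zero_normal_traceZ D (c : R) (n u v : 'rV[R]_3 -> 'rV[R]_3) :
  {in D, v =1 (fun x => c *: u x)} -> zero_normal_trace D n u ->
  zero_normal_trace D n v.
Proof.
move=> vE u0 x bx.
have : (fun y => c * dot (n x) (u y)) @ within D (nbhs x) --> c * 0.
  exact: cvgM (cvg_cst _) (u0 x bx).
rewrite mulr0; apply: cvg_trans; apply: near_eq_cvg.
by rewrite near_withinE; apply: nearW => y /mem_set /vE ->; rewrite dotZr.
Qed.

End partial_derivatives.

(** * Measurability, boundedness and square integrability *)

Section square_integrability.
Context {R : realType}.
Implicit Types (D : set 'rV[R]_3) (f : 'rV[R]_3 -> R).

Notation R3 := (measurableTypeR R * measurableTypeR R * measurableTypeR R)%type.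

Lemma row_norm_ltP (x : 'rV[R]_3) (e : R) : 0 < e ->
  (forall i, `|x 0 i| < e) <-> `|x| < e.
Proof.
move=> e0; have -> : `|x| < e <-> ball 0 e x.
  by rewrite mx_norm_ball /ball_/= sub0r normrN.
split=> [xe|[_ xe] i]; last first.
  by have := xe 0 i; rewrite /ball/= mxE sub0r normrN.
by split=> // i j; rewrite ord1 /ball/= mxE sub0r normrN.
Qed.

(** Balls of the maximum norm are cubes. This links the topology of row vectors to the product
    sigma-algebra. *)
Lemma vec3_box (p q : R3) (e : R) : 0 < e ->
  (((ball (p.1.1 : R) e `*` ball (p.1.2 : R) e) `*` ball (p.2 : R) e) q) <->
  ball (vec3 p) e (vec3 q).
Proof.
move=> e0; rewrite mx_norm_ball /ball_/= -row_norm_ltP//; split.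
  move=> [[]]; rewrite /ball/= => h1 h2 h3 i; rewrite !mxE.
  by case: i => -[|[|[|//]]] ?; rewrite !(tnth_nth 0).
move=> h; split; first split.
- by have := h (@Ordinal 3 0 isT); rewrite !mxE !(tnth_nth 0).
- by have := h (@Ordinal 3 1 isT); rewrite !mxE !(tnth_nth 0).
- by have := h (@Ordinal 3 2 isT); rewrite !mxE !(tnth_nth 0).
Qed.

Lemma measurable_box (p : R3) (e : R) :
  measurable ((ball (p.1.1 : R) e `*` ball (p.1.2 : R) e) `*` ball (p.2 : R) e
              : set R3).
Proof. by do 2?apply: measurableX; exact: measurable_ball. Qed.

(* An open set is the countable union of the rational boxes it contains. *)
Lemma open_measurable_vec3 (U : set 'rV[R]_3) :
  open U -> measurable (@vec3 R @^-1` U : set R3).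
Proof.
move=> oU.
pose c (q : rat * rat * rat) : R3 := (ratr q.1.1, ratr q.1.2, ratr q.2).
pose r k : R := k.+1%:R^-1.
(* Boxes not contained in [U] are replaced by [set0], so that the union runs over a whole countable
   type. *)
pose B (z : rat * rat * rat * nat) : set R3 :=
  if pselect (ball (vec3 (c z.1)) (r z.2) `<=` U) then
    (ball ((c z.1).1.1 : R) (r z.2) `*` ball ((c z.1).1.2 : R) (r z.2))
      `*` ball ((c z.1).2 : R) (r z.2)
  else set0.
have r0 k : 0 < r k by rewrite invr_gt0.
have -> : @vec3 R @^-1` U = \bigcup_z B z.
  apply/seteqP; split=> [p /= Up|p [z _]]; last first.
    rewrite /B; case: pselect => // BU pB; exact/BU/vec3_box.
  have /nbhs_ballP[e /= e0 eU] := open_nbhs_nbhs (conj oU Up).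
  (* A rational centre within [r k] of [p] then has its [r k]-ball inside the [e]-ball of [p], by
     the triangle inequality. *)
  have [k ke] : exists k, r k < e / 2.
    have e20 : 0 < e / 2 by rewrite divr_gt0.
    have [k _ /(_ k (leqnn k))] := near_infty_natSinv_lt (PosNum e20).
    by exists k.
  have approx (x : R) : exists q : rat, ball x (r k) (ratr q).
    have /rat_in_itvoo[q] : x - r k < x + r k.
      by rewrite ltrBlDr -addrA ltrDl addr_gt0.
    by exists q; rewrite ball_itv.
  have [q1 h1] := approx p.1.1; have [q2 h2] := approx p.1.2.
  have [q3 h3] := approx p.2.
  have pq : ball (vec3 p) (r k) (vec3 (c (q1, q2, q3))).
    by rewrite -vec3_box.
  exists (q1, q2, q3, k) => //; rewrite /B; case: pselect => [? /=|[]].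
    by apply/(vec3_box (c (q1, q2, q3))) => //; exact: ball_sym.
  move=> y qy; apply: eU.
  apply: le_ball (ball_triangle pq qy).
  by rewrite [leRHS]splitr lerD// ltW.
apply: countable_bigcupT_measurable => // z.
by rewrite /B; case: pselect => /= ?;
  [exact: (measurable_box (c z.1))|exact: measurable0].
Qed.

(** It suffices to test open intervals, whose preimages within [D] are open because [f] is
    continuous at every point of [D]. *)
Lemma continuous_measurable_vec3 D f : open D ->
  (forall x, D x -> {for x, continuous f}) ->
  measurable_fun (@vec3 R @^-1` D : set R3) (f \o @vec3 R).
Proof.
move=> oD cf; apply: (measurability _ (RGenOpens.measurableE R)).
move=> _ [_ [a [b ->] <-]].
apply: (@open_measurable_vec3 (D `&` f @^-1` `]a, b[)).
rewrite openE => x [Dx fx].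
apply: filterI; first exact: open_nbhs_nbhs.
exact: cf Dx _ (open_nbhs_nbhs (conj (interval_open _ _) fx)).
Qed.

(** Heine-Borel: the closure is a closed subset of a closed ball. *)
Lemma bounded_closure_compact D : bounded_set D -> compact (closure D).
Proof.
move=> /pinfty_ex_gt0[M M0 DM].
have DK : D `<=` closed_ball 0 M.
  move=> x Dx; rewrite closed_ballE// /closed_ball_/= sub0r normrN.
  exact: DM.
apply: (subclosed_compact (B := closed_ball 0 M)).
- exact: closed_closure.
- apply: bounded_closed_compact; last exact: closed_ball_closed.
  exists M; split=> [|N MN x]; first exact: gtr0_real.
  rewrite closed_ballE// /closed_ball_/= sub0r normrN => /le_trans; apply.
  exact: ltW.
- have /closure_id -> : closed (closed_ball (0 : 'rV[R]_3) M).
    exact: closed_ball_closed.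
  exact: closureS.
Qed.

Lemma smooth_closure_bounded D f : bounded_set D -> smooth_closure D f ->
  exists M, forall x, D x -> `|f x| <= M.
Proof.
(* The empty list of indices gives the continuous extension [h] of [f] itself. *)
move=> /bounded_closure_compact cD [_ /(_ [::])[h [ch hf]]].
have /compact_bounded/pinfty_ex_gt0[M _ hM] := continuous_compact ch cD.
exists M => x Dx; rewrite -[f x]hf//; apply: hM.
by exists x => //; exact: subset_closure.
Qed.

Lemma enorm_sqr (v : 'rV[R]_3) : enorm v ^+ 2 = \sum_(i < 3) v 0 i ^+ 2.
Proof.
rewrite sqr_sqrtr; first by apply: eq_bigr => i _; rewrite expr2.
by apply: sumr_ge0 => i _; rewrite -expr2 sqr_ge0.
Qed.

(** The set lies in a cube centred at the origin, whose measure is a product of three finite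
    lengths. *)
Lemma lebesgue3_bounded D : open D -> bounded_set D ->
  (lebesgue3 (@vec3 R @^-1` D) < +oo)%E.
Proof.
move=> oD /ex_strict_bound_gt0[M M0 DM].
pose I := ball (0 : R) M; pose B : set R3 := (I `*` I) `*` I.
have mI : measurable (I : set (measurableTypeR R)).
  exact: measurable_ball.
have muI : (@lebesgue_measure R I < +oo)%E.
  by rewrite /I lebesgue_measure_ball ?ltW// ltry.
apply: (@le_lt_trans _ _ (lebesgue3 B)).
  rewrite le_measure ?inE//.
  - exact: open_measurable_vec3.
  - exact: (measurable_box (0, 0, 0)).
  - move=> p /DM pM; apply/(@vec3_box (0, 0, 0)) => //.
    rewrite (_ : vec3 _ = 0) ?mx_norm_ball /ball_/= ?sub0r ?normrN//.
    by apply/rowP => -[[|[|[|//]]] ?]; rewrite !mxE (tnth_nth 0).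
rewrite /lebesgue3 product_measure1E//; last exact: measurableX.
rewrite [X in (X * _)%E]product_measure1E//.
rewrite !lte_mul_pinfty// ?ge0_fin_numE// ?mule_ge0//.
by rewrite lte_mul_pinfty// ge0_fin_numE.
Qed.

Lemma smooth_closure_vec_L2 D u : open D -> bounded_set D ->
  smooth_closure_vec D u -> L2_vec D u.
Proof.
move=> oD bD su.
have mD : measurable (@vec3 R @^-1` D : set R3) by exact: open_measurable_vec3.
have mu_ i : measurable_fun (@vec3 R @^-1` D : set R3)
    (fun p => coordf i u (vec3 p)).
  apply: continuous_measurable_vec3 => // x Dx.
  exact: ((su i).1 [::] x Dx).1.
split=> //.
have /choice[M uM] i := smooth_closure_bounded bD (su i).
(* Bounds on the coordinates give a constant bound on the integrand, integrable since [D] has finite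
   measure. *)
pose C := \sum_(i < 3) M i ^+ 2.
have mf : measurable_fun (@vec3 R @^-1` D : set R3)
    (fun p => (enorm (u (vec3 p)) ^+ 2)%:E).
  apply/measurable_EFinP; under eq_fun do rewrite enorm_sqr.
  by apply: measurable_sum => i; apply: measurable_funX; exact: mu_.
have uC p : (@vec3 R @^-1` D) p -> enorm (u (vec3 p)) ^+ 2 <= C.
  move=> Dp; rewrite enorm_sqr; apply: ler_sum => i _.
  have Mi : `|u (vec3 p) 0 i| <= M i := uM i _ Dp.
  by rewrite -real_normK ?num_real// ler_sqr ?nnegrE// (le_trans _ Mi).
apply: (@le_lt_trans _ _
  (\int[@lebesgue3 R]_(p in @vec3 R @^-1` D) cst C%:E p)%E).
  by apply: ge0_le_integral => // p Dp; rewrite lee_fin sqr_ge0.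
rewrite integral_cst// lte_mul_pinfty// ?lee_fin ?lebesgue3_bounded//.
by apply: sumr_ge0 => i _; exact: sqr_ge0.
Qed.

End square_integrability.

Theorem mainTheorem7 (R : realType) (G : set 'rV[R]_3)
    (n : 'rV[R]_3 -> 'rV[R]_3)
    (domG : bounded_domain G) (smoothG : smooth_boundary G)
    (normal_n : outward_unit_normal G n) :
  (forall (mu : R) (u : 'rV[R]_3 -> 'rV[R]_3),
     solution_P G n mu u -> solution_N G n mu (div u)) /\
  (forall (nu : R) (g : 'rV[R]_3 -> R),
     nu != 0 -> solution_N G n nu g -> solution_P G n nu (grad g)).
Proof.
have [oG _ _ bG] := domG; split=> [mu u|nu g nu0].
- move=> [mu0 [[x Gx ux0] [_ [su [Pu tu]]]]].
  (* This form of the equation serves twice: differentiated, it gives the equation for [div u]; in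
     the limit, the boundary condition. *)
  have gdE : {in G, grad (div u) =1 (fun y => - mu *: u y)}.
    by move=> y /set_mem /Pu guE; rewrite scaleNr -guE opprK.
  split; [|split; [|split]].
  + apply: contrapT => noy; move/eqP: ux0; apply.
    (* If [div u] vanished on [G], so would its gradient, and [mu *: u x] would be zero although
       [mu] and [u x] are not. *)
    have d0 : {in G, div u =1 cst 0}.
      move=> y /set_mem Gy; apply: contrapT => /eqP dy; apply: noy.
      by exists y.
    have /eqP := Pu _ Gx.
    rewrite (grad_constant_zero oG d0 (mem_set Gx)) /= oppr0 eq_sym scaler_eq0.
    by rewrite (negbTE mu0) => /eqP.
  + by apply: smooth_closure_sum => // i; exact/smooth_closure_partial/su.
  + move=> y Gy; rewrite /laplacian /div mulr_sumr -sumrN.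
    apply: eq_bigr => i _.
    have pdE : {in G, partial i (div u) =1 (fun z => - mu * coordf i u z)}.
      by move=> z /gdE/rowP/(_ i); rewrite !mxE.
    rewrite (eq_open_partial i oG pdE (mem_set Gy)) partialZ ?mulNr ?opprK//.
    by apply: smooth_on_derivable Gy; case: (su i).
  + exact: zero_normal_traceZ gdE tu.
- move=> [[x Gx gx0] [sg [Ng tg]]].
  have sgg : smooth_closure_vec G (grad g).
    by move=> i; rewrite coordf_grad; exact: smooth_closure_partial.
  split=> //; split; [|split; [|split; [|split]]] => //.
  + apply: contrapT => noy; move/eqP: gx0; apply.
    have g0 : {in G, grad g =1 cst 0}.
      move=> y /set_mem Gy; apply: contrapT => /eqP gy; apply: noy.
      by exists y.
    have /eqP := Ng _ Gx.
    rewrite (grad_zero_laplacian oG g0 (mem_set Gx)) /= oppr0 eq_sym mulf_eq0.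
    by rewrite (negbTE nu0) => /eqP.
  + exact: smooth_closure_vec_L2.
  + move=> y Gy; rewrite div_grad; apply/rowP => i; rewrite !mxE.
    (* Since [div (grad g)] is [laplacian g], differentiating this relation in direction [i] gives
       the [i]-th coordinate of the equation for [grad g]. *)
    have lE : {in G, laplacian g =1 (fun z => - nu * g z)}.
      by move=> z /set_mem /Ng gE; rewrite mulNr -gE opprK.
    rewrite (eq_open_partial i oG lE (mem_set Gy)) partialZ ?mulNr ?opprK//.
    by apply: smooth_on_derivable Gy; case: sg.
Qed.
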